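(* Let $H$ be a weak Hopf algebra over a field $\Bbbk$, let $C$ be a $\Bbbk$-coalgebra, and let $h\in H$. Then $C$ is a (left) partial $H$-comodule coalgebra via the map $\overline{\rho_h}:C\to H\otimes C$, $\overline{\rho_h}(c)=h\otimes c$, if and only if (i) $\varepsilon_H(h)=1_{\Bbbk}$; (ii) $(h\otimes 1_H)\Delta_H(h)=h\otimes h$.
   Context: All tensor products are over the field $\Bbbk$, all maps are $\Bbbk$-linear, and $V\otimes\Bbbk\simeq V\simeq\Bbbk\otimes V$ is used as an identification; coalgebras are coassociative and counital; Sweedler notation $\Delta(h)=h_1\otimes h_2$ is used, and $\tau_{V,W}:V\otimes W\to W\otimes V$ is the flip. $I_V$ is the identity map of $V$, and $m_H$ is the multiplication of $H$. A weak bialgebra $(H,m,u,\Delta,\varepsilon)$ is a vector space that is both an algebra and a coalgebra such that for all $h,k,\ell\in H$: (i) $\Delta(hk)=\Delta(h)\Delta(k)$; (ii) $\varepsilon(hk\ell)=\varepsilon(hk_1)\varepsilon(k_2\ell)=\varepsilon(hk_2)\varepsilon(k_1\ell)$; (iii) $(1_H\otimes\Delta(1_H))(\Delta(1_H)\otimes 1_H)=(\Delta(1_H)\otimes 1_H)(1_H\otimes\Delta(1_H))=\Delta^2(1_H)$, where $\Delta^2=(\Delta\otimes I)\Delta$. With $\Delta(1_H)=1_1\otimes 1_2$, define $\varepsilon_t(h)=\varepsilon(1_1h)1_2$ and $\varepsilon_s(h)=1_1\varepsilon(h1_2)$. A weak Hopf algebra is a weak bialgebra with a linear map $S:H\to H$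 (antipode) such that $h_1S(h_2)=\varepsilon_t(h)$, $S(h_1)h_2=\varepsilon_s(h)$, $S(h_1)h_2S(h_3)=S(h)$ for all $h\in H$. A coalgebra $C$ is a (left) partial $H$-comodule coalgebra via a linear map $\overline{\rho}:C\to H\otimes C$ if for all $c\in C$: (CCP1) $(\varepsilon_H\otimes I_C)\overline{\rho}(c)=c$; (CCP2) $(I_H\otimes\Delta_C)\overline{\rho}(c)=(m_H\otimes I_C\otimes I_C)(I_H\otimes\tau_{C,H}\otimes I_C)(\overline{\rho}\otimes\overline{\rho})\Delta_C(c)$; (CCP3) $(I_H\otimes\overline{\rho})\overline{\rho}(c)=(m_H\otimes I_H\otimes I_C)[(I_H\otimes\varepsilon_C)(\overline{\rho}(c_1))\otimes(\Delta_H\otimes I_C)(\overline{\rho}(c_2))]$.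
   Formalization: The coalgebra C is assumed nonzero: for C = 0 every h gives a partial comodule coalgebra although (i) fails for h = 0. The algebra H is also taken to be nonzero; for H = 0 and C nonzero both sides are false. *)

(* Defs.v *)
From HB Require Import structures.
From mathcomp Require Import all_boot all_order all_algebra.
From mathcomp Require Import generic_quotient boolp classical_sets.

Set Implicit Arguments.
Unset Strict Implicit.
Unset Printing Implicit Defensive.

Import GRing.Theory.
Local Open Scope ring_scope.
Local Open Scope quotient_scope.

(* A list [:: (v1, w1); ...; (vn, wn)] stands for v1 (x) w1 + ... + vn (x) wn.
   [tens_rel] is the congruence presenting V (x) W by generators and
   relations. *)
Inductive tens_rel (k : fieldType) (V W : lmodType k) :
    seq (V * W) -> seq (V * W) -> Prop :=
| tens_refl s : tens_rel s s
| tens_sym s t : tens_rel s t -> tens_rel t s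
| tens_trans s t u : tens_rel s t -> tens_rel t u -> tens_rel s u
| tens_cat s s' t t' :
    tens_rel s s' -> tens_rel t t' -> tens_rel (s ++ t) (s' ++ t')
| tens_catC s t : tens_rel (s ++ t) (t ++ s)
| tens_addl v v' w : tens_rel [:: (v + v', w)] [:: (v, w); (v', w)]
| tens_addr v w w' : tens_rel [:: (v, w + w')] [:: (v, w); (v, w')]
| tens_scale a v w : tens_rel [:: (a *: v, w)] [:: (v, a *: w)]
| tens_zero w : tens_rel [:: (0, w)] [::].

Section TensorQuotient.
Variables (k : fieldType) (V W : lmodType k).

Definition tens_relb (s t : seq (V * W)) : bool := `[< tens_rel s t >].

Fact tens_relb_refl : reflexive tens_relb.
Proof. by move=> s; apply/asboolP/tens_refl. Qed.
Fact tens_relb_sym : symmetric tens_relb.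
Proof. by move=> s t; apply/asboolP/asboolP => /tens_sym. Qed.
Fact tens_relb_trans : transitive tens_relb.
Proof.
move=> t s u /asboolP st /asboolP tu; apply/asboolP; exact: tens_trans st tu.
Qed.

Canonical tens_equiv :=
  EquivRel tens_relb tens_relb_refl tens_relb_sym tens_relb_trans.

Definition tensor := {eq_quot tens_equiv}.
HB.instance Definition _ := Choice.on tensor.
HB.instance Definition _ := EqQuotient.on tensor.

Lemma tens_eqP s t : \pi_tensor s = \pi_tensor t <-> tens_rel s t.
Proof. by split=> [/eqmodP/asboolP //|h]; apply/eqmodP/asboolP. Qed.

Lemma tens_repr s : tens_rel (repr (\pi_tensor s)) s.
Proof. by apply/tens_eqP; rewrite reprK. Qed.

Definition tens0 : tensor := \pi_tensor [::].
Definition tensD (x y : tensor) : tensor := \pi_tensor (repr x ++ repr y).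
Definition tensZ (a : k) (x : tensor) : tensor :=
  \pi_tensor [seq (a *: p.1, p.2) | p <- repr x].

Lemma tens_scalel a s t : tens_rel s t ->
  tens_rel [seq (a *: p.1, p.2) | p : V * W <- s]
           [seq (a *: p.1, p.2) | p : V * W <- t].
Proof.
elim=> /= {s t} [s|s t _|s t u _ h1 _|s s' t t' _ h1 _ h2|s t|v v' w|v w w'|b v w|w].
- exact: tens_refl.
- exact: tens_sym.
- exact: tens_trans.
- by rewrite !map_cat; apply: tens_cat.
- by rewrite !map_cat; apply: tens_catC.
- by rewrite scalerDr; apply: tens_addl.
- exact: tens_addr.
- by rewrite scalerA mulrC -scalerA; apply: tens_scale.
- by rewrite scaler0; apply: tens_zero.
Qed.

Lemma tensD_pi s t : tensD (\pi_tensor s) (\pi_tensor t) = \pi_tensor (s ++ t).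
Proof. by apply/tens_eqP/tens_cat; apply: tens_repr. Qed.

Lemma tensZ_pi a s :
  tensZ a (\pi_tensor s) = \pi_tensor [seq (a *: p.1, p.2) | p <- s].
Proof. by apply/tens_eqP/tens_scalel/tens_repr. Qed.

Lemma tens_piP (P : tensor -> Prop) : (forall s, P (\pi_tensor s)) -> forall x, P x.
Proof. by move=> h x; rewrite -[x]reprK. Qed.

Fact tensDA : associative tensD.
Proof.
do 3![elim/tens_piP=> ?]; by rewrite !tensD_pi catA.
Qed.
Fact tensDC : commutative tensD.
Proof.
do 2![elim/tens_piP=> ?]; rewrite !tensD_pi; apply/tens_eqP; exact: tens_catC.
Qed.
Fact tens0D : left_id tens0 tensD.
Proof. by elim/tens_piP=> ?; rewrite tensD_pi. Qed.

Lemma tensZ0 x : tensZ 0 x = tens0.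
Proof.
elim/tens_piP: x => s; rewrite tensZ_pi; apply/tens_eqP.
elim: s => [|p s IHs] /=; first exact: tens_refl.
rewrite scale0r -[_ :: _]cat1s -[[::]]cats0.
by apply: tens_cat => //; apply: tens_zero.
Qed.

Fact tensZA a b x : tensZ a (tensZ b x) = tensZ (a * b) x.
Proof.
elim/tens_piP: x => s; rewrite !tensZ_pi -map_comp.
by congr (\pi_tensor _); apply: eq_map => p /=; rewrite scalerA.
Qed.
Fact tens1Z : left_id 1 tensZ.
Proof.
elim/tens_piP=> s; rewrite tensZ_pi -[in RHS](map_id s).
by congr (\pi_tensor _); apply: eq_map => -[v w] /=; rewrite scale1r.
Qed.
Fact tensZDr : right_distributive tensZ tensD.
Proof.
by move=> a; do 2![elim/tens_piP=> ?]; rewrite !(tensD_pi, tensZ_pi) map_cat.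
Qed.
Fact tensZDl x : {morph tensZ^~ x : a b / a + b >-> tensD a b}.
Proof.
move=> a b; elim/tens_piP: x => s; rewrite !(tensD_pi, tensZ_pi).
apply/tens_eqP; elim: s => [|p s IHs] /=; first exact: tens_refl.
set sa := map _ s; set sb := map _ s; set sc := map _ s in IHs *.
apply: (@tens_trans _ _ _ _ ([:: (a *: p.1, p.2); (b *: p.1, p.2)] ++ (sb ++ sc))).
  rewrite -[_ :: sa]cat1s; apply: tens_cat => //.
  by rewrite scalerDl; apply: tens_addl.
rewrite /= -[(a *: _, _) :: _]cat1s -[(a *: _, _) :: sb ++ _]cat1s.
apply: tens_cat; first exact: tens_refl.
rewrite -[(b *: _, _) :: _]cat1s -[(b *: _, _) :: sc]cat1s !catA.
apply: tens_cat; last exact: tens_refl.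
exact: tens_catC.
Qed.

Fact tensND : left_inverse tens0 (tensZ (-1)) tensD.
Proof. by move=> x; rewrite -{2}[x]tens1Z -tensZDl addNr tensZ0. Qed.

HB.instance Definition _ := GRing.isZmodule.Build tensor tensDA tensDC tens0D tensND.
HB.instance Definition _ :=
  GRing.Zmodule_isLmodule.Build k tensor tensZA tens1Z tensZDr tensZDl.

Definition tens (v : V) (w : W) : tensor := \pi_tensor [:: (v, w)].

(* \sum_i f v_i w_i for x = \sum_i v_i (x) w_i; independent of the decomposition
   when [f] is bilinear (see [sweedler_tens], [sweedler_linear] and
   [sweedler_unique]), which is the only intended use. *)
Definition sweedler (U : lmodType k) (x : tensor) (f : V -> W -> U) : U :=
  \sum_(p <- repr x) f p.1 p.2.

End TensorQuotient.

Notation "V ⨂ W" := (tensor V W) (at level 40, left associativity).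
Notation "v ⊗ w" := (tens v w) (at level 40, left associativity) : ring_scope.

Section TensorTheory.
Variables (k : fieldType) (V W : lmodType k).

Lemma tens_pi (s : seq (V * W)) : \pi_(tensor V W) s = \sum_(p <- s) p.1 ⊗ p.2.
Proof.
elim: s => [|[v w] s IHs]; first by rewrite big_nil.
by rewrite big_cons -IHs /= /tens /GRing.add /= tensD_pi.
Qed.

Lemma tensE (x : V ⨂ W) : x = \sum_(p <- repr x) p.1 ⊗ p.2.
Proof. by rewrite -tens_pi reprK. Qed.

Lemma tensor_ind (P : V ⨂ W -> Prop) : P 0 ->
  (forall x y, P x -> P y -> P (x + y)) -> (forall v w, P (v ⊗ w)) ->
  forall x, P x.
Proof. by move=> P0 PD Pt x; rewrite [x]tensE; apply: big_ind. Qed.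

Lemma tens_bilinear : bilinear_for *:%R *:%R (@tens k V W).
Proof.
have sl a (v : V) (w : W) : (a *: v) ⊗ w = a *: (v ⊗ w).
  by rewrite /GRing.scale /= tensZ_pi.
have sr a (v : V) (w : W) : v ⊗ (a *: w) = a *: (v ⊗ w).
  by rewrite -sl; apply/tens_eqP/tens_sym/tens_scale.
split=> [w|v] a x y.
  rewrite /= -sl; apply: etrans (esym (tensD_pi _ _)).
  by apply/tens_eqP; apply: tens_addl.
rewrite /= -sr; apply: etrans (esym (tensD_pi _ _)).
by apply/tens_eqP; apply: tens_addr.
Qed.

HB.instance Definition _ (v : V) :=
  GRing.isLinear.Build k W (V ⨂ W) _ (tens v) (tens_bilinear.2 v).
HB.instance Definition _ :=
  bilinear_isBilinear.Build k V W (V ⨂ W) *:%R *:%R (@tens k V W) tens_bilinear.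

Lemma tensDl (v v' : V) (w : W) : (v + v') ⊗ w = v ⊗ w + v' ⊗ w.
Proof. by have := tens_bilinear.1 w 1 v v'; rewrite /= !scale1r. Qed.
Lemma tensDr (v : V) (w w' : W) : v ⊗ (w + w') = v ⊗ w + v ⊗ w'.
Proof. by have := tens_bilinear.2 v 1 w w'; rewrite /= !scale1r. Qed.
Lemma tens0l (w : W) : 0 ⊗ w = 0 :> V ⨂ W.
Proof. by apply: (addIr ((0 : V) ⊗ w)); rewrite -tensDl !add0r. Qed.
Lemma tens0r (v : V) : v ⊗ 0 = 0 :> V ⨂ W.
Proof. by apply: (addIr (v ⊗ (0 : W))); rewrite -tensDr !add0r. Qed.
Lemma tensZl a (v : V) (w : W) : (a *: v) ⊗ w = a *: (v ⊗ w).
Proof. by have := tens_bilinear.1 w a v 0; rewrite /= tens0l !addr0. Qed.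
Lemma tensZr a (v : V) (w : W) : v ⊗ (a *: w) = a *: (v ⊗ w).
Proof. by have := tens_bilinear.2 v a w 0; rewrite /= tens0r !addr0. Qed.

Variable U : lmodType k.

Section Lift.
Variables (f : V -> W -> U) (fbil : bilinear_for *:%R *:%R f).

Lemma sweedler_rel (s t : seq (V * W)) : tens_rel s t ->
  \sum_(p <- s) f p.1 p.2 = \sum_(p <- t) f p.1 p.2.
Proof.
have fDl v v' w : f (v + v') w = f v w + f v' w.
  by have := fbil.1 w 1 v v'; rewrite /= !scale1r.
have fDr v w w' : f v (w + w') = f v w + f v w'.
  by have := fbil.2 v 1 w w'; rewrite /= !scale1r.
have f0l w : f 0 w = 0 by apply: (addIr (f 0 w)); rewrite -fDl !add0r.
have f0r v : f v 0 = 0 by apply: (addIr (f v 0)); rewrite -fDr !add0r.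
elim=> {s t} [//|s t _ -> //|s t u _ -> _ -> //|s s' t t' _ h1 _ h2|s t|v v' w|v w w'|a v w|w];
  rewrite ?big_cat ?big_cons ?big_nil ?addr0 /=.
- by rewrite h1 h2.
- by rewrite addrC.
- exact: fDl.
- exact: fDr.
- have /= := fbil.1 w a v 0; have /= := fbil.2 v a w 0.
  by rewrite f0l f0r !addr0 => -> ->.
- exact: f0l.
Qed.

Lemma sweedler_pi (s : seq (V * W)) :
  sweedler (\pi_(tensor V W) s) f = \sum_(p <- s) f p.1 p.2.
Proof. by apply: sweedler_rel; apply: tens_repr. Qed.

Lemma sweedler_tens v w : sweedler (v ⊗ w) f = f v w.
Proof. by rewrite sweedler_pi big_seq1. Qed.

Lemma sweedler_linear : linear (fun x : V ⨂ W => sweedler x f).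
Proof.
have f0l w : f 0 w = 0.
  by have := fbil.1 w (-1) 0 0; rewrite /= scaler0 addr0 scaleN1r addNr.
move=> a; elim/tens_piP=> s; elim/tens_piP=> t.
rewrite [a *: _]tensZ_pi [_ + _]tensD_pi !sweedler_pi big_cat big_map /=.
congr (_ + _); rewrite scaler_sumr; apply: eq_bigr => p _.
by have /= := fbil.1 p.2 a p.1 0; rewrite f0l !addr0.
Qed.

Lemma sweedler_unique (g : {linear V ⨂ W -> U}) :
  (forall v w, g (v ⊗ w) = f v w) -> forall x, g x = sweedler x f.
Proof.
move=> gE x; rewrite {1}[x]tensE linear_sum /=.
by apply: eq_bigr => p _; rewrite gE.
Qed.

End Lift.
End TensorTheory.

Section LinearForm.
Variables (k : fieldType) (V : lmodType k) (v : V).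
Hypothesis v0 : v <> 0.

Let avoiding (A : set V) :=
  (forall a x y, A x -> A y -> A (a *: x + y)) /\ ~ A v.

Lemma exists_hyperplane : exists M : set V,
  [/\ M 0, forall a x y, M x -> M y -> M (a *: x + y), ~ M v &
      forall x, exists a, M (x - a *: v)].
Proof.
have [F FP Ftot|M [[Mlin Mv] Mmax]] := @Zorn_bigcup V avoiding.
  split=> [a x y [X FX Xx] [Y FY Yy]|[X FX]]; last exact: (FP _ FX).2.
  have [XY|YX] := Ftot _ _ FX FY; [exists Y => //|exists X => //].
    by apply: (FP _ FY).1 => //; apply: XY.
  by apply: (FP _ FX).1 => //; apply: YX.
have M0 : M 0.
  apply: contrapT => nM0; apply: (Mmax [set 0]%classic).
    split=> [x Mx|/(_ 0 erefl) //]; exfalso; apply: nM0.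
    by have := Mlin (-1) x x Mx Mx; rewrite scaleN1r addNr.
  by split=> [a x y -> ->|/v0 //]; rewrite /= scaler0 addr0.
have MZ a x : M x -> M (a *: x) by move=> Mx; rewrite -[_ *: _]addr0; apply: Mlin.
exists M; split=> // x.
have [Mx|nMx] := pselect (M x); first by exists 0; rewrite scale0r subr0.
apply: contrapT => nex.
apply: (Mmax (fun y => exists2 m, M m & exists b, y = m + b *: x)).
  split=> [m Mm|sub]; first by exists m => //; exists 0; rewrite scale0r addr0.
  by apply/nMx/sub; exists 0 => //; exists 1; rewrite scale1r add0r.
split=> [a _ _ [m Mm [b ->]] [m' Mm' [b' ->]]|[m Mm [b vE]]].
  exists (a *: m + m'); first exact: Mlin.
  by exists (a * b + b'); rewrite scalerDr scalerA scalerDl addrACA.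
apply: nex; exists b^-1.
have [b0|b0] := eqVneq b 0; first by case: Mv; rewrite vE b0 scale0r addr0.
rewrite {1}vE scalerDr scalerA mulVf // scale1r opprD addrCA subrr addr0.
by rewrite -scaleNr; apply: MZ.
Qed.

Lemma exists_linear_form : exists f : V -> k,
  (forall a x y, f (a *: x + y) = a * f x + f y) /\ f v = 1.
Proof.
have [M [M0 Mlin Mv Mex]] := exists_hyperplane.
have MZ a x : M x -> M (a *: x) by move=> Mx; rewrite -[_ *: _]addr0; apply: Mlin.
have uniq x a b : M (x - a *: v) -> M (x - b *: v) -> a = b.
  move=> Ma Mb; apply/eqP; rewrite -subr_eq0; apply/negPn/negP => ab.
  apply: Mv; have := MZ (a - b)^-1 _ (Mlin (-1) _ _ Ma Mb).
  by rewrite scaleN1r opprB addrA addrNK -scalerBl scalerA mulVf // scale1r.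
pose f x := projT1 (cid (Mex x)); have fP x : M (x - f x *: v) := projT2 (cid (Mex x)).
exists f; split=> [a x y|].
  apply: (uniq _ _ _ (fP _)); have := Mlin a _ _ (fP x) (fP y).
  by rewrite scalerBr addrACA -opprD scalerA -scalerDl.
by apply: (uniq _ _ _ (fP _)); rewrite scale1r subrr.
Qed.

End LinearForm.

Lemma tens_neq0 (k : fieldType) (V W : lmodType k) (v : V) (w : W) :
  v <> 0 -> w <> 0 -> v ⊗ w <> 0.
Proof.
move=> /exists_linear_form [f [flin fv]] /exists_linear_form [g [glin gw]] vw0.
have fg : bilinear_for *:%R *:%R (fun v w => f v * g w : k^o).
  split=> [y|x] a x1 x2 /=; rewrite (flin, glin) (mulrDl, mulrDr) /GRing.scale /=.
    by rewrite mulrA.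
  by rewrite mulrCA.
have := sweedler_tens fg v w; rewrite vw0 fv gw mulr1.
have := sweedler_linear fg (-1) 0 0; rewrite scaler0 addr0 scaleN1r addNr => ->.
by move=> /esym/eqP; rewrite oner_eq0.
Qed.

Section TensorMaps.
Variable k : fieldType.
Implicit Types U V W X : lmodType k.

Lemma tmap_bilinear V V' W W' (f : {linear V -> V'}) (g : {linear W -> W'}) :
  bilinear_for *:%R *:%R (fun v w => f v ⊗ g w).
Proof.
by split=> [w|v] a x y; rewrite /= linearP ?tensDl ?tensZl ?tensDr ?tensZr.
Qed.
Definition tmap V V' W W' (f : {linear V -> V'}) (g : {linear W -> W'})
  (x : V ⨂ W) : V' ⨂ W' := sweedler x (fun v w => f v ⊗ g w).
HB.instance Definition _ V V' W W' (f : {linear V -> V'}) (g : {linear W -> W'}) :=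
  GRing.isLinear.Build k (V ⨂ W) (V' ⨂ W') _ (tmap f g)
    (sweedler_linear (tmap_bilinear f g)).
Lemma tmap_tens V V' W W' (f : {linear V -> V'}) (g : {linear W -> W'}) v w :
  tmap f g (v ⊗ w) = f v ⊗ g w.
Proof. exact: sweedler_tens (tmap_bilinear f g) v w. Qed.

Lemma tflip_bilinear V W : bilinear_for *:%R *:%R (fun (v : V) (w : W) => w ⊗ v).
Proof. by split=> [w|v] a x y; rewrite ?tensDl ?tensZl ?tensDr ?tensZr. Qed.
Definition tflip V W (x : V ⨂ W) : W ⨂ V := sweedler x (fun v w => w ⊗ v).
HB.instance Definition _ V W :=
  GRing.isLinear.Build k (V ⨂ W) (W ⨂ V) _ (@tflip V W)
    (sweedler_linear (@tflip_bilinear V W)).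
Lemma tflip_tens V W (v : V) (w : W) : tflip (v ⊗ w) = w ⊗ v.
Proof. exact: sweedler_tens (@tflip_bilinear V W) v w. Qed.

(* The canonical identifications k (x) V = V = V (x) k. *)
Lemma tlunit_bilinear V : bilinear_for *:%R *:%R (fun (a : k^o) (v : V) => a *: v).
Proof.
split=> [v|b] a x y /=; first by rewrite scalerDl scalerA.
by rewrite scalerDr !scalerA mulrC.
Qed.
Definition tlunit V (x : k^o ⨂ V) : V := sweedler x (fun a v => a *: v).
HB.instance Definition _ V :=
  GRing.isLinear.Build k (k^o ⨂ V) V _ (@tlunit V)
    (sweedler_linear (@tlunit_bilinear V)).
Lemma tlunit_tens V (a : k^o) (v : V) : tlunit (a ⊗ v) = a *: v.
Proof. exact: sweedler_tens (@tlunit_bilinear V) a v. Qed.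

Definition trunit V (x : V ⨂ k^o) : V := tlunit (tflip x).
HB.instance Definition _ V :=
  GRing.Linear.copy (@trunit V) (@tlunit V \o @tflip V k^o).
Lemma trunit_tens V (v : V) (a : k^o) : trunit (v ⊗ a) = a *: v.
Proof. by rewrite /trunit tflip_tens tlunit_tens. Qed.

(* The associativity isomorphism and its inverse. *)
Lemma tassoc_bilinear2 U V W (w : W) :
  bilinear_for *:%R *:%R (fun (u : U) (v : V) => u ⊗ (v ⊗ w)).
Proof. by split=> [v|u] a x y; rewrite ?tensDl ?tensZl ?tensDr ?tensZr. Qed.
Lemma tassoc_bilinear U V W : bilinear_for *:%R *:%R
  (fun (y : U ⨂ V) (w : W) => sweedler y (fun u v => u ⊗ (v ⊗ w))).
Proof.
split=> [w|y] a x x'; first exact: (sweedler_linear (@tassoc_bilinear2 U V W w) a x x').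
rewrite /= scaler_sumr -big_split; apply: eq_bigr => p _ /=.
by rewrite tensDr tensZr tensDr tensZr.
Qed.
Definition tassoc U V W (x : (U ⨂ V) ⨂ W) : U ⨂ (V ⨂ W) :=
  sweedler x (fun y w => sweedler y (fun u v => u ⊗ (v ⊗ w))).
HB.instance Definition _ U V W :=
  GRing.isLinear.Build k ((U ⨂ V) ⨂ W) (U ⨂ (V ⨂ W)) _ (@tassoc U V W)
    (sweedler_linear (@tassoc_bilinear U V W)).
Lemma tassoc_tens U V W (u : U) (v : V) (w : W) :
  tassoc ((u ⊗ v) ⊗ w) = u ⊗ (v ⊗ w).
Proof.
rewrite /tassoc (sweedler_tens (@tassoc_bilinear U V W)).
exact: sweedler_tens (@tassoc_bilinear2 U V W w) u v.
Qed.

Definition tassocV U V W (x : U ⨂ (V ⨂ W)) : (U ⨂ V) ⨂ W :=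
  tflip (tassoc (tflip (tassoc (tflip x)))).
HB.instance Definition _ U V W :=
  GRing.Linear.copy (@tassocV U V W)
    (@tflip _ _ \o @tassoc W U V \o @tflip _ _ \o @tassoc V W U \o @tflip _ _).
Lemma tassocV_tens U V W (u : U) (v : V) (w : W) :
  tassocV (u ⊗ (v ⊗ w)) = (u ⊗ v) ⊗ w.
Proof. by rewrite /tassocV !(tflip_tens, tassoc_tens). Qed.

Lemma tassocK U V W : cancel (@tassoc U V W) (@tassocV U V W).
Proof.
elim/tensor_ind=> [|x y hx hy|y w]; rewrite ?linear0 ?[tassoc _]linearD /=
  ?[tassocV (_ + _)]linearD /= ?hx ?hy //.
elim/tensor_ind: y => [|x y hx hy|u v]; last by rewrite tassoc_tens tassocV_tens.
  by rewrite tens0l !linear0.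
by rewrite tensDl [tassoc _]linearD /= [tassocV (_ + _)]linearD /= hx hy.
Qed.

(* I (x) tau (x) I up to bracketing. *)
Definition tswap23 U V W X (x : (U ⨂ V) ⨂ (W ⨂ X)) : (U ⨂ W) ⨂ (V ⨂ X) :=
  tassocV (tmap idfun (@tassoc W V X)
    (tmap idfun (tmap (@tflip V W) idfun)
      (tmap idfun (@tassocV V W X) (tassoc x)))).
HB.instance Definition _ U V W X :=
  GRing.Linear.copy (@tswap23 U V W X)
    (@tassocV U W (V ⨂ X) \o tmap idfun (@tassoc W V X)
     \o tmap idfun (tmap (@tflip V W) idfun)
     \o tmap idfun (@tassocV V W X) \o @tassoc U V (W ⨂ X)).
Lemma tswap23_tens U V W X (u : U) (v : V) (w : W) (x : X) :
  tswap23 ((u ⊗ v) ⊗ (w ⊗ x)) = (u ⊗ w) ⊗ (v ⊗ x).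
Proof.
by rewrite /tswap23 tassoc_tens; do 5!rewrite ?(tmap_tens, tassocV_tens, tassoc_tens, tflip_tens) /=.
Qed.

End TensorMaps.

Section TensorAlgebra.
Variable k : fieldType.

Lemma mulm_bilinear (A : algType k) : bilinear_for *:%R *:%R (fun x y : A => x * y).
Proof.
by split=> [w|v] a x y /=; [rewrite mulrDl scalerAl|rewrite mulrDr scalerAr].
Qed.
Definition mulm (A : algType k) (x : A ⨂ A) : A := sweedler x (fun x y => x * y).
HB.instance Definition _ (A : algType k) :=
  GRing.isLinear.Build k (A ⨂ A) A _ (@mulm A) (sweedler_linear (@mulm_bilinear A)).
Lemma mulm_tens (A : algType k) (x y : A) : mulm (x ⊗ y) = x * y.
Proof. exact: sweedler_tens (@mulm_bilinear A) x y. Qed.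

Section Prod.
Variables A B : algType k.

Definition tensM (x y : A ⨂ B) : A ⨂ B :=
  tmap (@mulm A) (@mulm B) (tswap23 (x ⊗ y)).
Definition tens1 : A ⨂ B := 1 ⊗ 1.

Lemma tensM_tens a b a' b' : tensM (a ⊗ b) (a' ⊗ b') = (a * a') ⊗ (b * b').
Proof. by rewrite /tensM tswap23_tens tmap_tens /= !mulm_tens. Qed.
Lemma tensMDl : left_distributive tensM +%R.
Proof. by move=> x y z; rewrite /tensM tensDl [tswap23 _]linearD [LHS]linearD. Qed.
Lemma tensMDr : right_distributive tensM +%R.
Proof. by move=> x y z; rewrite /tensM tensDr [tswap23 _]linearD [LHS]linearD. Qed.
Lemma tensM0l x : tensM 0 x = 0.
Proof. by rewrite /tensM tens0l !linear0. Qed.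
Lemma tensM0r x : tensM x 0 = 0.
Proof. by rewrite /tensM tens0r !linear0. Qed.
Lemma tensMA : associative tensM.
Proof.
move=> x y z.
elim/tensor_ind: x => [|x x' h h'|a b]; first by rewrite !tensM0l.
  by rewrite !tensMDl h h'.
elim/tensor_ind: y => [|y y' h h'|a' b']; first by rewrite !(tensM0l, tensM0r).
  by rewrite !(tensMDl, tensMDr) h h'.
elim/tensor_ind: z => [|z z' h h'|a'' b'']; first by rewrite !tensM0r.
  by rewrite !tensMDr h h'.
by rewrite !tensM_tens !mulrA.
Qed.
Lemma tens1M : left_id tens1 tensM.
Proof.
elim/tensor_ind=> [|x y hx hy|a b]; first exact: tensM0r.
  by rewrite tensMDr hx hy.
by rewrite tensM_tens !mul1r.
Qed.
Lemma tensM1 : right_id tens1 tensM.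
Proof.
elim/tensor_ind=> [|x y hx hy|a b]; first exact: tensM0l.
  by rewrite tensMDl hx hy.
by rewrite tensM_tens !mulr1.
Qed.
Lemma tens1_neq0 : tens1 != 0.
Proof. by apply/eqP/tens_neq0; apply/eqP; rewrite oner_eq0. Qed.
HB.instance Definition _ := GRing.Zmodule_isNzRing.Build (A ⨂ B)
  tensMA tens1M tensM1 tensMDl tensMDr tens1_neq0.

Lemma tensMZl a (x y : A ⨂ B) : a *: (x * y) = (a *: x) * y.
Proof.
rewrite [in RHS]/GRing.mul /= /tensM tensZl [tswap23 _]linearZ.
by rewrite [RHS]linearZ.
Qed.
Lemma tensMZr a (x y : A ⨂ B) : a *: (x * y) = x * (a *: y).
Proof.
rewrite [in RHS]/GRing.mul /= /tensM tensZr [tswap23 _]linearZ.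
by rewrite [RHS]linearZ.
Qed.
HB.instance Definition _ := GRing.Lmodule_isLalgebra.Build k (A ⨂ B) tensMZl.
HB.instance Definition _ := GRing.Lalgebra_isAlgebra.Build k (A ⨂ B) tensMZr.

Lemma mul_tens a b a' b' : (a ⊗ b) * (a' ⊗ b') = (a * a') ⊗ (b * b') :> A ⨂ B.
Proof. exact: tensM_tens. Qed.

End Prod.
End TensorAlgebra.

Section WeakHopf.
Variable k : fieldType.

Record coalgebra (C : lmodType k)
    (Delta : {linear C -> C ⨂ C}) (eps : {linear C -> k^o}) : Prop := {
  coassoc : forall c, tassoc (tmap Delta idfun (Delta c)) = tmap idfun Delta (Delta c);
  counitl : forall c, tlunit (tmap eps idfun (Delta c)) = c;
  counitr : forall c, trunit (tmap idfun eps (Delta c)) = c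
}.

(* Triple tensors are bracketed to the right; [comult1l] and [comult1r] take
   place in the algebra H (x) (H (x) H). *)
Record weak_bialgebra (H : algType k)
    (Delta : {linear H -> H ⨂ H}) (eps : {linear H -> k^o}) : Prop := {
  weak_bialgebra_coalgebra : coalgebra Delta eps;
  comultM : forall x y, Delta (x * y) = Delta x * Delta y;
  counitM12 : forall x y z,
    eps (x * y * z) = sweedler (Delta y) (fun y1 y2 => eps (x * y1) * eps (y2 * z));
  counitM21 : forall x y z,
    eps (x * y * z) = sweedler (Delta y) (fun y1 y2 => eps (x * y2) * eps (y1 * z));
  comult1l : (1 ⊗ Delta 1) * tassoc (Delta 1 ⊗ 1) = tassoc (tmap Delta idfun (Delta 1));
  comult1r : tassoc (Delta 1 ⊗ 1) * (1 ⊗ Delta 1) = tassoc (tmap Delta idfun (Delta 1))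
}.

Definition eps_t (H : algType k)
    (Delta : {linear H -> H ⨂ H}) (eps : {linear H -> k^o}) (x : H) : H :=
  sweedler (Delta 1) (fun e1 e2 => eps (e1 * x) *: e2).

Definition eps_s (H : algType k)
    (Delta : {linear H -> H ⨂ H}) (eps : {linear H -> k^o}) (x : H) : H :=
  sweedler (Delta 1) (fun e1 e2 => eps (x * e2) *: e1).

Record weak_hopf_algebra (H : algType k)
    (Delta : {linear H -> H ⨂ H}) (eps : {linear H -> k^o})
    (S : {linear H -> H}) : Prop := {
  weak_hopf_weak_bialgebra : weak_bialgebra Delta eps;
  antipode_t : forall x,
    sweedler (Delta x) (fun x1 x2 => x1 * S x2) = eps_t Delta eps x;
  antipode_s : forall x,
    sweedler (Delta x) (fun x1 x2 => S x1 * x2) = eps_s Delta eps x;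
  antipode_anti : forall x,
    sweedler (Delta x) (fun x1 y =>
      sweedler (Delta y) (fun x2 x3 => S x1 * x2 * S x3)) = S x
}.

Record partial_comodule_coalgebra (H : algType k)
    (DeltaH : {linear H -> H ⨂ H}) (epsH : {linear H -> k^o})
    (C : lmodType k) (DeltaC : {linear C -> C ⨂ C}) (epsC : {linear C -> k^o})
    (rho : {linear C -> H ⨂ C}) : Prop := {
  ccp1 : forall c, tlunit (tmap epsH idfun (rho c)) = c;
  ccp2 : forall c,
    tmap idfun DeltaC (rho c)
    = tmap (@mulm k H) idfun (tswap23 (tmap rho rho (DeltaC c)));
  ccp3 : forall c,
    tmap idfun rho (rho c)
    = tmap (@mulm k H) idfun (tassocV
        (tmap (@trunit k H \o tmap idfun epsC \o rho)
              (@tassoc k H H C \o tmap DeltaH idfun \o rho) (DeltaC c)))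
}.

End WeakHopf.

(* Main.v *)
Require Import Defs.
From HB Require Import structures.
From mathcomp Require Import all_boot all_order all_algebra.

(** Insert rho = tens h into the three comodule axioms. Since rho moves no part
    of c, each axiom becomes a comparison of two elements of H (or of H ⨂ H)
    tensored with the same element of C:
    - CCP1 reads epsH h *: c = c;
    - CCP2 reads h ⊗ Delta c = (h * h) ⊗ Delta c [ccp2_rhs];
    - CCP3 reads h ⊗ h ⊗ c = ((h ⊗ 1) * Delta h) ⊗ c, the counit of C
      absorbing the leg c_1 [ccp3_rhs].
    Over a field a nonzero c may be cancelled [tens_injl], so CCP1 and CCP3 at
    one nonzero c give (i) and (ii). Conversely (i) and (ii) give CCP1 and CCP3
    at once, and CCP2 needs in addition that h is idempotent. Applying the
    counit to the second leg of (ii) yields h * h = epsH h *: h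
    [idempotent_of_comult], which is h by (i). *)

Set Implicit Arguments.
Unset Strict Implicit.
Unset Printing Implicit Defensive.

Import GRing.Theory.
Local Open Scope ring_scope.

Lemma tensor_ext (k : fieldType) (V W U : lmodType k)
    (f g : {linear V ⨂ W -> U}) :
  (forall v w, f (v ⊗ w) = g (v ⊗ w)) -> f =1 g.
Proof.
by move=> fg; elim/tensor_ind=> [|x y hx hy|//]; rewrite ?linear0 // !linearD hx hy.
Qed.

(** Cancellation depends on the base being a field: a linear form taking the
    value 1 at w recovers v from v ⊗ w, and over a general ring w might be
    torsion. *)
Lemma tens_injl (k : fieldType) (V W : lmodType k) (w : W) :
  w <> 0 -> injective (fun v : V => v ⊗ w).
Proof.
move=> w0 x y /= xy; apply/eqP; rewrite -subr_eq0; apply/negPn/negP => /eqP xy0.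
apply: (tens_neq0 xy0 w0).
by rewrite tensDl xy -tensDl subrr tens0l.
Qed.

Section ConstantCoaction.
Variables (k : fieldType) (H : algType k).
Variables (DeltaH : {linear H -> H ⨂ H}) (epsH : {linear H -> k^o}).
Variables (C : lmodType k) (epsC : {linear C -> k^o}).
Implicit Types (h a : H) (c : C).

(** The elements h produced by the two coactions are independent of the legs
    of y, so they can be multiplied together outside of the sum over y. *)
Lemma ccp2_rhs h (y : C ⨂ C) :
  tmap (@mulm k H) idfun (tswap23 (tmap (tens h) (tens h) y)) = (h * h) ⊗ y.
Proof.
pose f : {linear C ⨂ C -> H ⨂ (C ⨂ C)} :=
  tmap (@mulm k H) idfun \o @tswap23 k H C H C \o tmap (tens h) (tens h).
apply: (tensor_ext (f := f) (g := tens (h * h))) => c c' /=.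
by rewrite tmap_tens tswap23_tens tmap_tens /= mulm_tens.
Qed.

Lemma mul_first_leg a (z : H ⨂ H) c :
  tmap (@mulm k H) idfun (tassocV (a ⊗ tassoc (z ⊗ c)))
  = tassoc (((a ⊗ 1) * z) ⊗ c).
Proof.
elim/tensor_ind: z => [|x y hx hy|x y].
- by rewrite mulr0 !tens0l !linear0.
- by rewrite mulrDr !tensDl !linearD /= hx hy.
- by rewrite tassoc_tens tassocV_tens tmap_tens /= mulm_tens mul_tens mul1r tassoc_tens.
Qed.

(** Only the scalar epsC c_1 survives from the first coaction. It moves across
    the tensor sign to c_2, where it restores c by counitality when y is the
    coproduct of c. *)
Lemma ccp3_rhs h (y : C ⨂ C) :
  tmap (@mulm k H) idfun (tassocV
    (tmap (@trunit k H \o tmap idfun epsC \o tens h)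
          (@tassoc k H H C \o tmap DeltaH idfun \o tens h) y))
  = tassoc (((h ⊗ 1) * DeltaH h) ⊗ tlunit (tmap epsC idfun y)).
Proof.
pose f : {linear C ⨂ C -> H ⨂ (H ⨂ C)} :=
  tmap (@mulm k H) idfun \o @tassocV k H H (H ⨂ C) \o
  tmap (@trunit k H \o tmap idfun epsC \o tens h)
       (@tassoc k H H C \o tmap DeltaH idfun \o tens h).
pose g : {linear C ⨂ C -> H ⨂ (H ⨂ C)} :=
  @tassoc k H H C \o tens ((h ⊗ 1) * DeltaH h) \o @tlunit k C \o tmap epsC idfun.
apply: (tensor_ext (f := f) (g := g)) => c c' /=.
rewrite !tmap_tens /= !tmap_tens /= trunit_tens mul_first_leg.
by rewrite tlunit_tens tensZr !tensZl -tensMZl tensZl.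
Qed.

Lemma counit_second_leg a (z : H ⨂ H) :
  trunit (tmap idfun epsH ((a ⊗ 1) * z)) = a * trunit (tmap idfun epsH z).
Proof.
elim/tensor_ind: z => [|x y hx hy|x y].
- by rewrite mulr0 !linear0 mulr0.
- by rewrite mulrDr !linearD /= hx hy mulrDr.
- by rewrite mul_tens mul1r !tmap_tens !trunit_tens /= scalerAr.
Qed.

Lemma idempotent_of_comult h : coalgebra DeltaH epsH ->
  (h ⊗ 1) * DeltaH h = h ⊗ h -> h * h = epsH h *: h.
Proof.
move=> HH hh; have := counit_second_leg h (DeltaH h).
by rewrite (counitr HH) hh tmap_tens trunit_tens.
Qed.

End ConstantCoaction.

Theorem proposition3p10 (k : fieldType)
    (H : algType k) (DeltaH : {linear H -> H ⨂ H}) (epsH : {linear H -> k^o})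
    (S : {linear H -> H}) (HwH : weak_hopf_algebra DeltaH epsH S)
    (C : lmodType k) (DeltaC : {linear C -> C ⨂ C}) (epsC : {linear C -> k^o})
    (HC : coalgebra DeltaC epsC) (C_neq0 : exists c : C, c <> 0)
    (h : H) :
  partial_comodule_coalgebra DeltaH epsH DeltaC epsC (tens h)
  <-> (epsH h = 1 /\ (h ⊗ 1) * DeltaH h = h ⊗ h).
Proof.
have HH := weak_bialgebra_coalgebra (weak_hopf_weak_bialgebra HwH).
split=> [[ccp1 _ ccp3]|[eps1 hh]].
  have [c c0] := C_neq0; split.
    have := ccp1 c; rewrite tmap_tens tlunit_tens /= => ec.
    apply/eqP; rewrite -subr_eq0; apply/negPn/negP => e1; apply: c0.
    by apply: (scalerI e1); rewrite scalerBl ec scale1r subrr scaler0.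
  have := ccp3 c; rewrite ccp3_rhs (counitl HC) tmap_tens /= -tassoc_tens.
  by move=> /(can_inj (@tassocK k H H C)) /(tens_injl c0).
split=> c.
- by rewrite tmap_tens tlunit_tens /= eps1 scale1r.
- by rewrite ccp2_rhs tmap_tens (idempotent_of_comult HH hh) eps1 scale1r.
- by rewrite ccp3_rhs (counitl HC) hh tmap_tens tassoc_tens.
Qed.
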